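(* Let $r\ge 2$ and let $C^{a}_{b,k}$ denote the $(a,b)$-optimal weights. Then: (i) for all integers $l,k$ with $1\le l\le r$, $0\le k\le l$ and $k\le r-1$, $$C^{r+l-1}_{l-1,k}=\frac{1}{2^{2l}}\left(\frac{r+l}{l}\right)\left(\frac{l-k}{r-k}\right)\binom{l}{k}\binom{r}{k}^{-1}\binom{2l}{l}\binom{l+r}{r}^{-1}\binom{2r}{2k+1};$$ (ii) for all integers $l,k$ with $1\le l\le r-1$ and $0\le k\le l$, $$C^{r+l-1}_{l,k}=\frac{1}{2^{2l}}\left(\frac{2l+1}{2r-1}\right)\left(\frac{r+l}{l}\right)\left(\frac{k}{r-k}\right)\binom{l}{k}\binom{r}{k}^{-1}\binom{2l}{l}\binom{l+r}{r}^{-1}\binom{2r}{2k+1}.$$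
   Context: Fix an integer $r\ge 2$, a mesh size $h>0$, and nodes $x_i=ih$, $i\in\mathbb{Z}$. Fix an index $j$ and let $x_{j-\frac12}=(j-\frac12)h$. For integers $a\ge 1$ and $b$, let $S^a_b=\{x_{j+b-a},x_{j+b-a+1},\dots,x_{j+b}\}$ ($a+1$ consecutive nodes), and for real data $(f_i)$ let $p^a_b$ be the polynomial of degree at most $a$ interpolating $f_i$ at the nodes $x_i\in S^a_b$. Optimal weights: for $r\le a\le 2r-1$ and $a-r\le b\le r-1$, the $(a,b)$-optimal weights are the constants $C^a_{b,k}$, $b-(a-r)\le k\le b$ (depending only on $r,a,b,k$), such that for all data $(f_i)$ $$p^a_b(x_{j-\frac12})=\sum_{k=b-(a-r)}^{b}C^a_{b,k}\,p^r_k(x_{j-\frac12}),\qquad \sum_{k=b-(a-r)}^{b}C^a_{b,k}=1.$$ For the other indices $0\le k\le r-1$, one sets $C^a_{b,k}=0$. *)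

(* Defs.v *)
From HB Require Import structures.
From mathcomp Require Import all_boot all_order all_algebra all_field.
From mathcomp Require Import boolp classical_sets reals.

Set Implicit Arguments.
Unset Strict Implicit.
Unset Printing Implicit Defensive.

Import Order.TTheory GRing.Theory Num.Theory.
Local Open Scope classical_set_scope.
Local Open Scope ring_scope.

Definition node (R : realType) (h : R) (i : int) : R := i%:~R * h.

Definition half_node (R : realType) (h : R) (j : int) : R :=
  (j%:~R - 2%:R^-1) * h.

(* [i] is the index of a node of the stencil S^a_b = {x_(j+b-a), .., x_(j+b)}. *)
Definition in_stencil (j : int) (a : nat) (b : int) (i : int) : bool :=
  (j + b - a%:Z <= i) && (i <= j + b).

(* [size p <= a.+1] says that [p] has degree at most [a]. *)
Definition interpolates (R : realType) (h : R) (j : int) (a : nat) (b : int)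
    (f : int -> R) (p : {poly R}) : Prop :=
  (size p <= a.+1)%N /\
  forall i : int, in_stencil j a b i -> p.[node h i] = f i.

(* p^a_b; existence and uniqueness for h > 0 are [interpP] and [interp_uniq]. *)
Definition interp (R : realType) (h : R) (j : int) (a : nat) (b : int)
    (f : int -> R) : {poly R} :=
  xget 0 [set p | interpolates h j a b f p].

(* The weights are to depend only on r, a, b and k: hence one family [c] must
   work for every mesh size h, every index j and all data f.  The natural
   subtractions [b - (a - r)] are exact when r <= a and a - r <= b.  Only the
   values c k with b - (a - r) <= k <= b are constrained. *)
Definition are_optimal_weights (R : realType) (r a b : nat) (c : nat -> R) :
    Prop :=
  (forall (h : R) (j : int) (f : int -> R), 0 < h ->
     (interp h j a b%:Z f).[half_node h j] =
     \sum_(b - (a - r) <= k < b.+1)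
        c k * (interp h j r k%:Z f).[half_node h j]) /\
  \sum_(b - (a - r) <= k < b.+1) c k = 1.

(* C^a_{b,k}, meaningful for r <= a <= 2r-1, a-r <= b <= r-1 and k <= r-1.
   If no weights existed, the value would be 0. *)
Definition opt_weight (R : realType) (r a b k : nat) : R :=
  if (b - (a - r) <= k <= b)%N
  then xget (fun=> 0) [set c : nat -> R | are_optimal_weights r a b c] k
  else 0.

Lemma node_inj (R : realType) (h : R) : 0 < h -> injective (node h).
Proof.
move=> h0 i i' /(mulIf (lt0r_neq0 h0)) /eqP.
by rewrite eqr_int => /eqP.
Qed.

Lemma in_stencilP (j : int) (a : nat) (b i : int) :
  reflect (exists m : 'I_a.+1, i = j + b - a%:Z + m%:Z) (in_stencil j a b i).
Proof.
apply: (iffP andP) => [[lo hi]|[m ->]].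
- case em: (i - (j + b - a%:Z)) => [m|m]; last by move: lo; rewrite -subr_ge0 em.
  have lm : (m < a.+1)%N.
    by rewrite ltnS -lez_nat -[m%:Z]em lerBlDr addrC subrK.
  by exists (Ordinal lm); rewrite /= -[m%:Z]em addrC subrK.
- rewrite lerDl; split=> //.
  by rewrite -addrA gerDl addrC subr_le0 lez_nat -ltnS.
Qed.

Lemma interp_uniq (R : realType) (h : R) (j : int) (a : nat) (b : int)
    (f : int -> R) (p q : {poly R}) :
  0 < h -> interpolates h j a b f p -> interpolates h j a b f q -> p = q.
Proof.
move=> h0 [sp ip] [sq iq].
pose x (m : nat) := node h (j + b - a%:Z + m%:Z).
have x_inj : injective x by move=> m m' /(node_inj h0) /addrI [].
rewrite (lagrange_gen (x := x) _ x_inj sp) // (lagrange_gen (x := x) _ x_inj sq) //.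
apply: eq_bigr => m _.
by rewrite ip ?iq //; apply/in_stencilP; exists m.
Qed.

Lemma interpP (R : realType) (h : R) (j : int) (a : nat) (b : int)
    (f : int -> R) :
  0 < h -> interpolates h j a b f (interp h j a b f).
Proof.
move=> h0; rewrite /interp.
pose x (m : nat) := node h (j + b - a%:Z + m%:Z).
have x_inj : injective x by move=> m m' /(node_inj h0) /addrI [].
case: xgetP => // /(_ (\sum_(m < a.+1)
  (f (j + b - a%:Z + m%:Z))%:P * (tnth (lagrange a.+1 x) m : {poly R}))) [].
split.
- apply: (leq_trans (size_sum _ _ _)); apply/bigmax_leqP => m _.
  rewrite mul_polyC (leq_trans (size_scale_leq _ _)) ?size_lagrange_ //.
- move=> _ /in_stencilP[m ->].
  rewrite horner_sum (bigD1 m) //= big1 => [|m' nm].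
    by rewrite mul_polyC hornerZ -/(x m) lagrange_sample // eqxx mulr1 addr0.
  by rewrite mul_polyC hornerZ -/(x m) lagrange_sample // (negPf nm) mulr0.
Qed.

(* Main.v *)
Require Import Defs.
From mathcomp Require Import all_boot all_order all_algebra.
From mathcomp Require Import reals.
From mathcomp Require Import boolp classical_sets zify ring lra.
Import Order.TTheory GRing.Theory Num.Theory.
Local Open Scope ring_scope.
Set Implicit Arguments.
Unset Strict Implicit.
Unset Printing Implicit Defensive.

(** The closed forms come from counting lattice paths.  Aitken's recursion
    expresses p^(a+1)_b through p^a_b and p^a_(b-1); at the half node it becomes
    p^(a+1)_b = ((2(a-b)+1) p^a_b + (2b+1) p^a_(b-1)) / (2(a+1))
    ([interp_half_rec]).  Descending from p^(r+s)_b to p^r_(b-m) takes s steps,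
    of which m lower b and the other s-m lower a-b.  The numerator
    of a step depends only on the coordinate that the step lowers, and its
    denominator only on a, so the product of the factors is the same along all
    'C(s, m) paths.  With
    [x]_m = x (x-2) ... (x-2m+2), the coefficient of p^r_(b-m) is therefore
    'C(s, m) [2b+1]_m [2(r+s-b)-1]_(s-m) / [2(r+s)]_s
    ([weight]); the recursion reduces to Pascal's rule ([weightSS]) and gives
    [interp_half_weight].  The constant data 1 show that these weights sum to 1.

    Weights are unique because the system that they satisfy is triangular: for
    data supported at the leftmost node of the k-th stencil, the interpolants on
    the stencils further right vanish, and the k-th one does not vanish at the
    half node, since its r roots are all the other nodes of its stencil
    ([optimal_weights_uniq]).  Hence [opt_weight] is [weight] ([opt_weightE]).

    Finally the odd products [2n-1]_m are quotients of factorials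
    ([weight_fact]), and both formulas become identities between factorials. *)

(** * Interpolation at the half node *)

Lemma in_stencil_lS (j : int) (a : nat) (b i : int) :
  in_stencil j a.+1 b i = (i == j + b - a.+1%:Z) || in_stencil j a b i.
Proof. rewrite /in_stencil; lia. Qed.

Lemma in_stencil_rS (j : int) (a : nat) (b i : int) :
  in_stencil j a.+1 b i = (i == j + b) || in_stencil j a (b - 1) i.
Proof. rewrite /in_stencil; lia. Qed.

(** Aitken's recursion: the right-hand side has the right degree, and at each
    end of the stencil one of its two terms vanishes and the other one gives the
    datum; at the inner nodes both interpolants agree with the data and the two
    linear factors differ by the length of the stencil. *)
Lemma interp_aitken (R : realType) (h : R) (j : int) (a : nat) (b : int)
    (f : int -> R) : 0 < h ->
  interp h j a.+1 b f =
  (a.+1%:R * h)^-1 *: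
    (('X - (node h (j + b - a.+1%:Z))%:P) * interp h j a b f
     - ('X - (node h (j + b))%:P) * interp h j a (b - 1) f).
Proof.
move=> h0; apply: (interp_uniq h0 (interpP j a.+1 b f h0)).
have [sp ip] := interpP j a b f h0.
have [sq iq] := interpP j a (b - 1) f h0.
have size_linear (x : R) (p : {poly R}) :
    (size p <= a.+1)%N -> (size (('X - x%:P) * p)%R <= a.+2)%N.
  move=> sp'; apply: (leq_trans (size_polyMleq _ _)).
  by rewrite size_XsubC.
split.
  apply: (leq_trans (size_scale_leq _ _)).
  apply: (leq_trans (size_polyD _ _)).
  by rewrite size_polyN geq_max !size_linear.
move=> i hi.
rewrite hornerZ hornerD hornerN !hornerM !hornerXsubC.
have hn : h != 0 by rewrite lt0r_neq0.
have an : (a.+1%:R : R) != 0 by rewrite pnatr_eq0.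
have gap : node h (j + b) - node h (j + b - a.+1%:Z) = a.+1%:R * h.
  by rewrite /node -mulrBl -rmorphB opprB addrC subrK.
have cancel_gap y : (a.+1%:R * h)^-1 * (a.+1%:R * h * y) = y.
  by rewrite mulrA mulVf ?mul1r // mulf_neq0.
have [ei|ni] := eqVneq i (j + b).
  rewrite ei subrr mul0r subr0 ip ?gap ?cancel_gap //.
  by rewrite /in_stencil; lia.
have hq : in_stencil j a (b - 1) i.
  by move: hi; rewrite in_stencil_rS (negPf ni).
have [ei|ni'] := eqVneq i (j + b - a.+1%:Z).
  by rewrite iq // ei subrr mul0r sub0r -mulNr opprB gap cancel_gap.
have hp : in_stencil j a b i.
  by move: hi; rewrite in_stencil_lS (negPf ni').
by rewrite ip // iq // -mulrBl opprB addrC addrA subrK gap cancel_gap.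
Qed.

Lemma interp_half_rec (R : realType) (h : R) (j : int) (a : nat) (b : int)
    (f : int -> R) : 0 < h ->
  (interp h j a.+1 b f).[half_node h j] =
  ((2%:R * (a%:R - b%:~R) + 1) * (interp h j a b f).[half_node h j]
   + (2%:R * b%:~R + 1) * (interp h j a (b - 1) f).[half_node h j])
  / (2%:R * a.+1%:R).
Proof.
move=> h0; rewrite interp_aitken // hornerZ hornerD hornerN !hornerM !hornerXsubC.
rewrite /half_node /node.
set P := _.[_]; set Q := _.[_].
rewrite !(rmorphD, rmorphN) /= -!pmulrn -!natr1.
have an : (a%:R + 1 : R) != 0 by rewrite natr1 pnatr_eq0.
have hn : h != 0 by rewrite lt0r_neq0.
by field; rewrite an hn.
Qed.

(** * The lattice path coefficients *)

(** The falling factorial of step 2, which for odd [x] is a quotient of double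
    factorials. *)
Definition ffact2 (R : pzRingType) (x : R) (m : nat) : R :=
  \prod_(v < m) (x - 2%:R * v%:R).

Lemma ffact2_0 (R : pzRingType) (x : R) : ffact2 x 0 = 1.
Proof. by rewrite /ffact2 big_ord0. Qed.

Lemma ffact2S (R : pzRingType) (x : R) (m : nat) :
  ffact2 x m.+1 = x * ffact2 (x - 2%:R) m.
Proof.
rewrite /ffact2 big_ord_recl /= mulr0 subr0; congr (_ * _).
apply: eq_bigr => v _.
by rewrite /bump leq0n natrD mulrDr mulr1 opprD addrA.
Qed.

(** The index is the distance [m = b - k] to the right end of the range, and [b]
    is a scalar, so that the recursion can lower [b] without any bound on it. *)
Definition weight (R : fieldType) (r s : nat) (b : R) (m : nat) : R :=
  'C(s, m)%:R * ffact2 (2%:R * b + 1) m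
  * ffact2 (2%:R * (r%:R + s%:R - b) - 1) (s - m)
  / ffact2 (2%:R * (r%:R + s%:R)) s.

Lemma weight_small (R : fieldType) (r s : nat) (b : R) (m : nat) :
  (s < m)%N -> weight r s b m = 0.
Proof. by move=> sm; rewrite /weight bin_small // !mul0r. Qed.

Lemma weight0S (R : fieldType) (r s : nat) (b : R) :
  weight r s.+1 b 0 =
  (2%:R * (r%:R + s%:R - b) + 1) * weight r s b 0 / (2%:R * (r%:R + s.+1%:R)).
Proof.
rewrite /weight !bin0 !subn0 !ffact2_0 !ffact2S -[s.+1%:R]natr1.
have -> : 2%:R * (r%:R + (s%:R + 1) - b) - 1 = 2%:R * (r%:R + s%:R - b) + 1 by ring.
have -> : 2%:R * (r%:R + s%:R - b) + 1 - 2%:R = 2%:R * (r%:R + s%:R - b) - 1 by ring.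
have -> : 2%:R * (r%:R + (s%:R + 1)) - 2%:R = 2%:R * (r%:R + s%:R) :> R by ring.
by rewrite !mul1r !invfM; ring.
Qed.

(** Pascal's rule: after the common factors are removed, the two terms of the
    recursion differ only in their binomial coefficient. *)
Lemma weightSS (R : fieldType) (r s : nat) (b : R) (m : nat) :
  weight r s.+1 b m.+1 =
  ((2%:R * (r%:R + s%:R - b) + 1) * weight r s b m.+1
   + (2%:R * b + 1) * weight r s (b - 1) m) / (2%:R * (r%:R + s.+1%:R)).
Proof.
have [sm|ms] := ltnP s m.
  by rewrite !weight_small ?mulr0 ?addr0 ?mul0r //; lia.
rewrite /weight binS natrD subSS !ffact2S -[s.+1%:R]natr1.
have -> : 2%:R * (r%:R + (s%:R + 1) - b) - 1 = 2%:R * (r%:R + s%:R - b) + 1 by ring.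
have -> : 2%:R * (r%:R + s%:R - (b - 1)) - 1 = 2%:R * (r%:R + s%:R - b) + 1 by ring.
have -> : 2%:R * (r%:R + (s%:R + 1)) - 2%:R = 2%:R * (r%:R + s%:R) :> R by ring.
have -> : 2%:R * (b - 1) + 1 = 2%:R * b + 1 - 2%:R by ring.
rewrite !invfM.
(* At m = s the truncated s - m.+1 is 0 where the product would need length -1;
   there the binomial of the first term vanishes. *)
have [ms'|] := ltnP m s; last first.
  move=> sm; have -> : m = s by lia.
  by rewrite bin_small //; ring.
have -> : (s - m)%N = (s - m.+1).+1 by lia.
rewrite ffact2S.
have -> : 2%:R * (r%:R + s%:R - b) + 1 - 2%:R = 2%:R * (r%:R + s%:R - b) - 1 by ring.
by ring.
Qed.

Lemma interp_half_weight (R : realType) (h : R) (j : int) (r s : nat) (b : int)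
    (f : int -> R) : 0 < h ->
  (interp h j (r + s) b f).[half_node h j] =
  \sum_(0 <= m < s.+1) weight r s b%:~R m
     * (interp h j r (b - m%:Z) f).[half_node h j].
Proof.
move=> h0; elim: s b => [|s IH] b.
  rewrite big_nat1 addn0 subr0 /weight subnn !ffact2_0 bin0.
  by rewrite invr1 !mulr1 mul1r.
rewrite addnS interp_half_rec // !IH.
rewrite [RHS]big_nat_recl // weight0S.
under [in RHS]eq_bigr do rewrite weightSS.
rewrite [X in (_ * X + _) / _]big_nat_recl //.
(* A term of weight zero aligns the two ranges of summation. *)
have extend : \sum_(0 <= i < s) weight r s (b%:~R : R) i.+1
      * (interp h j r (b - i.+1%:Z) f).[half_node h j] =
    \sum_(0 <= i < s.+1) weight r s b%:~R i.+1
      * (interp h j r (b - i.+1%:Z) f).[half_node h j].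
  by rewrite big_nat_recr //= weight_small // mul0r addr0.
rewrite extend mulrDr -addrA !mulr_sumr -big_split mulrDl mulr_suml /=.
rewrite -addnS !(natrD _ r); congr (_ + _); first by ring.
apply: eq_bigr => m _.
have -> : b - 1 - m%:Z = b - m.+1%:Z by lia.
by rewrite rmorphB /=; ring.
Qed.

(** * Optimal weights exist and are unique *)

Lemma interp_cst1 (R : realType) (h : R) (j : int) (a : nat) (b : int) :
  0 < h -> interp h j a b (fun=> 1) = 1.
Proof.
move=> h0; apply: (interp_uniq h0 (interpP j a b _ h0)).
by split=> [|i _]; rewrite ?size_poly1 ?hornerE.
Qed.

Lemma weight_optimal (R : realType) (r s b : nat) : (s <= b)%N ->
  are_optimal_weights r (r + s) b (fun k => weight r s (b%:R : R) (b - k)).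
Proof.
move=> sb.
have reindex (F : nat -> R) :
    \sum_(b - s <= k < b.+1) F k = \sum_(0 <= m < s.+1) F (b - m)%N.
  rewrite -{1}[(b - s)%N]add0n big_addn big_nat_rev /=.
  have -> : (b.+1 - (b - s))%N = s.+1 by lia.
  by apply: eq_big_nat => m hm; congr F; lia.
have half (h : R) (j : int) (f : int -> R) : 0 < h ->
   (interp h j (r + s) b%:Z f).[half_node h j] =
   \sum_(b - s <= k < b.+1)
      weight r s b%:R (b - k) * (interp h j r k%:Z f).[half_node h j].
  move=> h0; rewrite interp_half_weight // reindex.
  apply: eq_big_nat => m hm.
  have -> : (b - (b - m))%N = m by lia.
  by have -> : b%:Z - m%:Z = (b - m)%N by lia.
split; rewrite addKn // .
have := half 1 0 (fun=> 1) ltr01.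
rewrite interp_cst1 // hornerE => {2}->.
by apply: eq_bigr => k _; rewrite interp_cst1 // hornerE mulr1.
Qed.

(** Otherwise the odd number 1 would be twice an integer. *)
Lemma half_node_neq (R : realType) (h : R) (j i : int) :
  0 < h -> node h i != half_node h j.
Proof.
move=> h0; apply/eqP => /(mulIf (lt0r_neq0 h0)) e.
have : ((2 * (j - i))%:~R : R) = 1%:~R.
  by rewrite rmorphM rmorphB /= e; field.
by move=> /eqP; rewrite eqr_int => /eqP; lia.
Qed.

(** An interpolant of degree at most [a] that vanishes at all nodes but the
    leftmost already has [a] roots there; one more root would make it zero. *)
Lemma interp_half_neq0 (R : realType) (h : R) (j : int) (a : nat) (b : int)
    (f : int -> R) : 0 < h -> f (j + b - a%:Z) != 0 ->
  (forall i, j + b - a%:Z < i -> f i = 0) ->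
  (interp h j a b f).[half_node h j] != 0.
Proof.
move=> h0 f0 fz; have [sp ip] := interpP j a b f h0.
set p := interp _ _ _ _ _ in sp ip *.
apply: contraNN f0 => pz.
have i0 : in_stencil j a b (j + b - a%:Z) by rewrite /in_stencil; lia.
rewrite -ip //.
suff -> : p = 0 by rewrite horner0.
apply/eqP; apply: contraTT sp => pn.
pose rs := half_node h j ::
  [seq node h (j + b - a%:Z + m.+1%:Z) | m <- iota 0 a].
have <- : size rs = a.+1 by rewrite /= size_map size_iota.
rewrite -ltnNge; apply: max_poly_roots => //.
  rewrite /= /root pz /=; apply/allP => x /mapP[m]; rewrite mem_iota => hm ->.
  by rewrite /root ip ?fz //; rewrite /in_stencil; lia.
rewrite /= map_inj_uniq ?iota_uniq ?andbT.
  by apply/mapP => -[m _ /esym/eqP]; rewrite (negPf (half_node_neq _ _ _)).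
by move=> m m' /(node_inj h0); lia.
Qed.

(** Data supported at the leftmost node of the [k]-th stencil isolate [c k] once
    the weights of smaller index are known to agree. *)
Lemma optimal_weights_uniq (R : realType) (r a b : nat) (c c' : nat -> R) :
  are_optimal_weights r a b c -> are_optimal_weights r a b c' ->
  forall k, (b - (a - r) <= k <= b)%N -> c k = c' k.
Proof.
move=> [hc _] [hc' _]; elim/ltn_ind => k IH hk.
pose f (i : int) : R := (i == k%:Z - r%:Z)%:R.
pose y n := (interp 1 0 r n%:Z f).[half_node 1 0].
have right0 n : (k < n)%N -> y n = 0.
  move=> kn; rewrite /y (_ : interp _ _ _ _ _ = 0) ?horner0 //.
  apply: (interp_uniq ltr01 (interpP 0 r n f ltr01)).
  split=> [|i hi]; first by rewrite size_poly0.
  by rewrite horner0 /f; case: eqP => // ei; move: hi; rewrite /in_stencil; lia.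
have yk : y k != 0.
  apply: interp_half_neq0 => //; first by rewrite /f add0r eqxx oner_neq0.
  by move=> i hi; rewrite /f; case: eqP => //; lia.
have := hc 1 0 f ltr01; rewrite (hc' 1 0 f ltr01).
have kr : k \in index_iota (b - (a - r)) b.+1 by rewrite mem_index_iota; lia.
rewrite (bigD1_seq k) ?iota_uniq //= [RHS](bigD1_seq k) ?iota_uniq //=.
rewrite -/(y k).
have rest : \sum_(b - (a - r) <= i < b.+1 | i != k) c' i * y i
          = \sum_(b - (a - r) <= i < b.+1 | i != k) c i * y i.
  rewrite big_seq_cond [RHS]big_seq_cond.
  apply: eq_bigr => i /andP[]; rewrite mem_index_iota => hi ni.
  have [ik|ki] := ltnP i k; first by rewrite IH //; lia.
  by rewrite right0 ?mulr0 //; lia.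
rewrite rest => /addIr /(mulIf yk) //.
Qed.

Lemma opt_weightE (R : realType) (r s b k : nat) :
  (s <= b)%N -> (b - s <= k <= b)%N ->
  opt_weight R r (r + s) b k = weight r s b%:R (b - k).
Proof.
move=> sb hk; rewrite /opt_weight addKn hk.
have opt := @weight_optimal R r s b sb.
case: xgetP => [c _ hc|/(_ _ opt)//].
by apply: (optimal_weights_uniq hc opt); rewrite addKn.
Qed.

(** * Weights in terms of factorials *)

Lemma natr_fact_neq0 (R : numFieldType) (n : nat) : n`!%:R != 0 :> R.
Proof. by rewrite pnatr_eq0 -lt0n fact_gt0. Qed.

Lemma natr_factS (R : numFieldType) (n : nat) :
  n.+1`!%:R = (n%:R + 1) * n`!%:R :> R.
Proof. by rewrite factS natrM natr1. Qed.

Lemma ffact2_even (R : numFieldType) (n m : nat) :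
  ffact2 (2%:R * (n + m)%:R : R) m = 2%:R ^+ m * (n + m)`!%:R / n`!%:R.
Proof.
elim: m => [|m IH]; first by rewrite ffact2_0 addn0 mul1r divff ?natr_fact_neq0.
rewrite ffact2S addnS factS natrM -[(n + m).+1%:R]natr1 mulrDr mulr1 addrK IH exprS.
by field; rewrite natr_fact_neq0.
Qed.

Lemma ffact2_odd (R : numFieldType) (n m : nat) :
  ffact2 (2%:R * (n + m)%:R - 1 : R) m =
  (2 * (n + m))`!%:R * n`!%:R / (2%:R ^+ m * (n + m)`!%:R * (2 * n)`!%:R).
Proof.
elim: m => [|m IH]; first by rewrite ffact2_0 addn0 mul1r; field; rewrite !natr_fact_neq0.
rewrite ffact2S addnS.
have -> : 2%:R * (n + m).+1%:R - 1 - 2%:R = 2%:R * (n + m)%:R - 1 :> R.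
  by rewrite -[(n + m).+1%:R]natr1; ring.
rewrite IH mulnS add2n !factS !natrM exprS.
rewrite -[(2 * (n + m)).+2%:R]natr1 -[(2 * (n + m)).+1%:R]natr1 -[(n + m).+1%:R]natr1.
rewrite natrM.
have := natr_fact_neq0 R (2 * n); have := natr_fact_neq0 R (n + m).
have np : ((n + m)%:R + 1 : R) != 0 by rewrite natr1 pnatr_eq0.
move: (n + m)`!%:R (2 * n)`!%:R => u v.
move: (n + m)%:R np => z np un vn.
by field; rewrite np un vn expf_neq0 // pnatr_eq0.
Qed.

Lemma natr_bin (R : numFieldType) (n m : nat) :
  'C(n + m, n)%:R = (n + m)`!%:R / (n`!%:R * m`!%:R) :> R.
Proof.
have := bin_fact (leq_addr m n); rewrite addKn => <-.
by rewrite !natrM mulfK // mulf_neq0 // natr_fact_neq0.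
Qed.

(** The parameters are the independent lengths [m = b - k], [t = s - m] and
    [q = r - k].  One factor 2(k+1) of (2(k+1))! has been cancelled against
    (k+1)!, because (2k+1)! is what occurs in the binomial of 2r over 2k+1. *)
Lemma weight_fact (R : numFieldType) (k q m t : nat) :
  weight (k + q) (m + t) ((k + m)%:R : R) m =
  (m + t)`!%:R / (m`!%:R * t`!%:R)
  * ((2 * (k + m).+1)`!%:R * k`!%:R
     / (2%:R ^+ m.+1 * (k + m).+1`!%:R * (2 * k).+1`!%:R))
  * ((2 * (q + t))`!%:R * q`!%:R / (2%:R ^+ t * (q + t)`!%:R * (2 * q)`!%:R))
  * ((k + q)`!%:R / (2%:R ^+ (m + t) * (k + q + (m + t))`!%:R)).
Proof.
rewrite /weight natr_bin addKn.
have -> : 2%:R * (k + m)%:R + 1 = 2%:R * (k.+1 + m)%:R - 1 :> R.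
  by rewrite addSn -[(k + m).+1%:R]natr1; ring.
have -> : (k + q)%:R + (m + t)%:R - (k + m)%:R = (q + t)%:R :> R.
  by rewrite !natrD; ring.
rewrite -natrD !ffact2_odd ffact2_even addSn mulnS add2n (mulnS 2 k) add2n.
rewrite (natr_factS _ k) (natr_factS _ (2 * k).+1) -[(2 * k).+1%:R]natr1.
rewrite (natrM _ 2 k) exprS.
have tn p : (2%:R ^+ p : R) != 0 by rewrite expf_neq0 // pnatr_eq0.
have n2k : (2%:R * k%:R + 1 + 1 : R) != 0.
  by rewrite -natrM !natr1 pnatr_eq0.
have := (natr_fact_neq0 R (2 * k).+1, natr_fact_neq0 R (k + m).+1,
  natr_fact_neq0 R m, natr_fact_neq0 R t, natr_fact_neq0 R (q + t),
  natr_fact_neq0 R (2 * q), natr_fact_neq0 R (k + q),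
  natr_fact_neq0 R (k + q + (m + t)), tn m, tn t, tn (m + t)%N).
move: (2 * (k + m)).+2`!%:R (2 * (q + t))`!%:R => A B nz.
by field; rewrite !nz n2k.
Qed.

Theorem theorem4p1 (R : realType) (r : nat) (hr : (2 <= r)%N) :
  (forall l k : nat, (1 <= l <= r)%N -> (k <= l)%N -> (k <= r - 1)%N ->
     opt_weight R r (r + l - 1) (l - 1) k =
       1 / 2%:R ^+ (2 * l) * ((r%:R + l%:R) / l%:R)
       * ((l%:R - k%:R) / (r%:R - k%:R))
       * 'C(l, k)%:R * ('C(r, k)%:R)^-1
       * 'C(2 * l, l)%:R * ('C(l + r, r)%:R)^-1
       * 'C(2 * r, 2 * k + 1)%:R) /\
  (forall l k : nat, (1 <= l <= r - 1)%N -> (k <= l)%N ->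
     opt_weight R r (r + l - 1) l k =
       1 / 2%:R ^+ (2 * l) * ((2%:R * l%:R + 1) / (2%:R * r%:R - 1))
       * ((r%:R + l%:R) / l%:R) * (k%:R / (r%:R - k%:R))
       * 'C(l, k)%:R * ('C(r, k)%:R)^-1
       * 'C(2 * l, l)%:R * ('C(l + r, r)%:R)^-1
       * 'C(2 * r, 2 * k + 1)%:R).
Proof.
have tn (p : nat) : (2%:R ^+ p : R) != 0 by rewrite expf_neq0 // pnatr_eq0.
split=> l k hl kl => [kr|].
  (* With b = l - 1 and a - b = r, the range of k is 0 .. l - 1; the formula
     vanishes at k = l. *)
  have [ekl|nkl] := eqVneq k l.
    rewrite ekl subrr mul0r mulr0 !mul0r /opt_weight ifF //; lia.
  have [m em] : exists m, l = (k + m).+1 by exists (l - k.+1)%N; lia.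
  have [q erq] : exists q, r = (k + q.+1)%N by exists (r - k.+1)%N; lia.
  have -> : (r + l - 1)%N = (r + (m + k))%N by lia.
  have -> : (l - 1)%N = (k + m)%N by lia.
  rewrite opt_weightE; [|lia|lia].
  rewrite addKn {1}erq weight_fact -erq -em (_ : q.+1 + k = r)%N; last by lia.
  have -> : 'C(l, k) = 'C(k + m.+1, k) by rewrite em addnS.
  have -> : 'C(r, k) = 'C(k + q.+1, k) by rewrite erq.
  have -> : 'C(2 * l, l) = 'C(l + l, l) by rewrite mul2n addnn.
  have -> : 'C(l + r, r) = 'C(r + l, r) by rewrite addnC.
  have -> : 'C(2 * r, 2 * k + 1) = 'C((2 * k).+1 + (2 * q).+1, (2 * k).+1).
    congr 'C(_, _); lia.
  rewrite !natr_bin -erq.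
  rewrite (_ : (2 * k).+1 + (2 * q).+1 = 2 * r)%N; last by lia.
  rewrite (_ : l + l = 2 * l)%N; last by lia.
  rewrite (_ : r + l = (r + (m + k)).+1)%N; last by lia.
  rewrite (_ : k + m.+1 = l)%N; last by lia.
  rewrite (_ : 2 * q.+1 = (2 * q).+2)%N; last by lia.
  have -> : (2 ^+ (2 * l) : R) = (2 * 2 ^+ m * 2 ^+ k) ^+ 2.
    by rewrite -exprS -exprD -exprM; congr (_ ^+ _); lia.
  have El : l`!%:R = (m%:R + k%:R + 1) * (m + k)`!%:R :> R.
    by rewrite em addnC natr_factS natrD.
  have er : r%:R = k%:R + (q%:R + 1) :> R by rewrite erq natrD natr1.
  have el : l%:R = m%:R + k%:R + 1 :> R by rewrite em addnC -natr1 natrD.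
  rewrite El (natr_factS _ q) (natr_factS _ m) (natr_factS _ (2 * q).+1).
  rewrite (natr_factS _ (r + (m + k))) -[(2 * q).+1%:R]natr1 (natrM _ 2 q).
  rewrite exprS exprD (natrD _ r) (natrD _ m k) er el.
  have nz := (natr_fact_neq0 R k, natr_fact_neq0 R m, natr_fact_neq0 R q,
    natr_fact_neq0 R r, natr_fact_neq0 R (m + k), natr_fact_neq0 R (2 * q).+1,
    natr_fact_neq0 R (2 * k).+1, natr_fact_neq0 R (2 * l),
    natr_fact_neq0 R (2 * r), natr_fact_neq0 R (r + (m + k)), tn m, tn k).
  have [k0 m0 q0] := And3 (ler0n R k) (ler0n R m) (ler0n R q).
  by field; repeat (apply/andP; split); rewrite ?nz //; apply: lt0r_neq0; lra.
(* With b = l and a - b = r - 1, the range of k is 1 .. l; the formula vanishes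
   at k = 0. *)
case: k kl => [|k] kl.
  by rewrite !(mul0r, mulr0) /opt_weight ifF //; lia.
have [m em] : exists m, l = (k.+1 + m)%N by exists (l - k.+1)%N; lia.
have [q erq] : exists q, r = (k.+1 + q.+1)%N by exists (r - k.+2)%N; lia.
(* The falling factorial of step 2 attached to a - b starts at 2r - 3 = 2p - 1. *)
have [p ep] : exists p, r = p.+1 by exists r.-1; lia.
have -> : (r + l - 1)%N = (r + (m + k))%N by lia.
rewrite opt_weightE; [|lia|lia].
rewrite em addKn {1}erq weight_fact -erq -em (_ : q.+1 + k = p)%N; last by lia.
have -> : 'C(l, k.+1) = 'C(k.+1 + m, k.+1) by rewrite em.
have -> : 'C(r, k.+1) = 'C(k.+1 + q.+1, k.+1) by rewrite erq.
have -> : 'C(2 * l, l) = 'C(l + l, l) by rewrite mul2n addnn.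
have -> : 'C(l + r, r) = 'C(r + l, r) by rewrite addnC.
have -> : 'C(2 * r, 2 * k.+1 + 1) = 'C((2 * k.+1).+1 + (2 * q).+1, (2 * k.+1).+1).
  congr 'C(_, _); lia.
rewrite !natr_bin -erq -em.
rewrite (_ : (2 * k.+1).+1 + (2 * q).+1 = (2 * p).+2)%N; last by lia.
rewrite (_ : l + l = 2 * l)%N; last by lia.
rewrite (_ : r + l = (r + (m + k)).+1)%N; last by lia.
rewrite (_ : 2 * q.+1 = (2 * q).+2)%N; last by lia.
rewrite (_ : 2 * l.+1 = (2 * l).+2)%N; last by lia.
have -> : (2 ^+ (2 * l) : R) = (2 * 2 ^+ m * 2 ^+ k) ^+ 2.
  by rewrite -exprS -exprD -exprM; congr (_ ^+ _); lia.
have er : r%:R = p%:R + 1 :> R by rewrite ep natr1.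
have epq : p%:R = k%:R + (q%:R + 1) :> R by rewrite natr1 -natrD; congr _%:R; lia.
have el : l%:R = m%:R + k%:R + 1 :> R by rewrite em addnC addnS -natr1 natrD.
have El : l`!%:R = (m%:R + k%:R + 1) * (m + k)`!%:R :> R.
  by rewrite em addnC addnS natr_factS natrD.
have Er : r`!%:R = (p%:R + 1) * p`!%:R :> R by rewrite ep natr_factS.
rewrite (natr_factS _ (2 * l).+1) (natr_factS _ (2 * l)) (natr_factS _ l).
rewrite (natr_factS _ (2 * p).+1) (natr_factS _ (2 * p)) (natr_factS _ k).
rewrite (natr_factS _ (2 * q).+1) (natr_factS _ q) (natr_factS _ (r + (m + k))).
rewrite -[(2 * q).+1%:R]natr1 -[(2 * l).+1%:R]natr1 -[(2 * p).+1%:R]natr1.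
rewrite -[k.+1%:R]natr1 !(natrM _ 2) (natrD _ r) (natrD _ m k).
rewrite El Er exprS exprD er el epq.
have nz := (natr_fact_neq0 R k, natr_fact_neq0 R m, natr_fact_neq0 R q,
  natr_fact_neq0 R p, natr_fact_neq0 R (m + k), natr_fact_neq0 R (2 * q).+1,
  natr_fact_neq0 R (2 * k.+1).+1, natr_fact_neq0 R (2 * l),
  natr_fact_neq0 R (2 * p), natr_fact_neq0 R (r + (m + k)), tn m, tn k).
have [k0 m0 q0] := And3 (ler0n R k) (ler0n R m) (ler0n R q).
by field; repeat (apply/andP; split); rewrite ?nz //; apply: lt0r_neq0; lra.
Qed.
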